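(* Let $(\mathcal{L}_k)_{k\ge2}$ be a sequence of finite triangulations of closed orientable surfaces such that the number of $2$-simplices of $\mathcal{L}_k$ tends to infinity and, for some constant $c>0$, $\varphi(G_k)\ge c$ for all $k$, where $G_k$ is the dual graph of $\mathcal{L}_k$. Let $\mathbb{K}$ be the fixed triangulated Klein bottle described in the context and let $\mathbb{U}_k$ be the simplicial connected sum of $\mathcal{L}_k$ with $\mathbb{K}$. Let $\lambda_{\min}^k$ be the smallest eigenvalue of $\Delta_{2,\mathrm{down}}^{\mathbb{U}_k}$. Then there exists a constant $\epsilon>0$ such that $$h_{\mathrm{vol}}(\mathbb{U}_k)>\epsilon\quad\text{for all }k,\qquad\text{while}\qquad\lim_{k\to\infty}\lambda_{\min}^k=0.$$
   Context: **Down Laplacian.** For a finite simplicial complex $\mathcal{X}$ with real chains carrying the inner product making oriented simplices orthonormal, $\Delta_{2,\mathrm{down}}^{\mathcal{X}}=(\partial_2^{\mathcal{X}})^*\partial_2^{\mathcal{X}}$ on $C_2^{\mathcal{X}}$. **Cheeger constants.** For a finite graph $\Gamma=(V,E)$, $\varphi(\Gamma)=\min_{0<|S|\le|V|/2}|E(S,S^c)|/|S|$, with $E(S,S^c)$ the set of edges between $S$ and its complement. The dual graph of a triangulated surface has the $2$-simplices as vertices, with two joined by an edge if they share an edge. For a triangulated closed surface $\mathcal{X}$, $h_{\mathrm{vol}}(\mathcal{X})$ is $\varphi$ of its dual graph. **The Klein bottle $\mathbb{K}$.** Take the rectangle $[0,4]\times[0,3]$ subdivided into unit squares, each square with lower-left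 corner $(x,y)$ divided into two triangles by the diagonal from $(x,y)$ to $(x+1,y+1)$; identify $(0,y)\sim(4,y)$ and $(x,0)\sim(4-x,3)$. **Connected sum.** $\mathbb{U}_k$ is obtained by removing one $2$-simplex from each of $\mathcal{L}_k$ and $\mathbb{K}$ and identifying the resulting boundary triangles edge by edge. It is a triangulated closed non-orientable surface. (Sequences $(\mathcal{L}_k)$ as in the claim are known to exist.) *)

(* Defs.v *)
From HB Require Import structures.
From mathcomp Require Import all_boot all_order all_algebra.

Set Implicit Arguments.
Unset Strict Implicit.
Unset Printing Implicit Defensive.

Import Order.TTheory GRing.Theory Num.Theory.

Local Open Scope ring_scope.

(* A complex is a family X of finite sets over an ambient finite type T.      *)
(* Its vertices are the v with [set v] \in X; the other elements of T play    *)
(* no role.                                                                   *)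

Section Complexes.
Variables (T : finType) (X : {set {set T}}).

Definition simplicial_complex : Prop :=
  set0 \notin X /\
  (forall A B : {set T}, A \in X -> B \subset A -> B != set0 -> B \in X).

Definition simplices (p : nat) : {set {set T}} := [set A in X | #|A| == p.+1].

Definition vertex_link (v : T) : {set {set T}} :=
  [set A in X | (v \notin A) && ((v |: A) \in X)].

Definition simplicial_circle (Y : {set {set T}}) : Prop :=
  exists c : seq T, [/\ uniq c, (2 < size c)%N &
    Y = [set [set x] | x in c] :|: [set [set x; next c x] | x in c]].

Definition skeleton1 : rel T := [rel x y | [set x; y] \in X].

(* Since every vertex link is a circle, X is automatically pure of            *)
(* dimension 2 and each edge lies in exactly two 2-simplices.                 *)
Definition closed_surface : Prop :=
  [/\ simplicial_complex,
      X != set0,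
      forall x y, [set x] \in X -> [set y] \in X -> connect skeleton1 x y &
      forall v, [set v] \in X -> simplicial_circle (vertex_link v)].

(* Every simplex gets the reference orientation [v_0, ..., v_p] in which its  *)
(* vertices increase for the enumeration of T.  The coefficient of the        *)
(* simplex B in the boundary \sum_i (-1)^i [v_0, .., ^v_i, .., v_p] of A:     *)
Definition incidence (R : nzRingType) (A B : {set T}) : R :=
  \sum_(v in A | B == A :\ v)
    (-1) ^+ #|[set u in A | (enum_rank u < enum_rank v)%N]|.

(* o A tells whether A is given the opposite of its reference orientation;    *)
(* two 2-simplices sharing an edge must induce opposite orientations on it.   *)
Definition orientable : Prop :=
  exists o : {set T} -> bool,
    forall A B E, A \in simplices 2 -> B \in simplices 2 -> A != B ->
      E \in simplices 1 -> E \subset A -> E \subset B ->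
      (-1) ^+ o A * incidence int A E + (-1) ^+ o B * incidence int B E = 0.

(* The matrix of the boundary map from C_p to C_(p-1) (p > 0) in the          *)
(* orthonormal bases of oriented simplices, acting on column vectors.         *)
Definition boundary_mx (R : nzRingType) (p : nat) :
    'M[R]_(#|simplices p.-1|, #|simplices p|) :=
  \matrix_(i, j) incidence R (enum_val j) (enum_val i).

Definition down_laplacian (R : nzRingType) (p : nat) : 'M[R]_#|simplices p| :=
  (boundary_mx R p)^T *m boundary_mx R p.

Definition dual_vertex : finType := {A : {set T} | A \in simplices 2}.

Definition dual_graph : rel dual_vertex := fun A B =>
  (A != B) && [exists E in simplices 1, (E \subset val A) && (E \subset val B)].

End Complexes.

Arguments dual_graph {T} X.

Definition smallest_eigenvalue (F : realFieldType) (n : nat) (A : 'M[F]_n)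
    (a : F) : Prop :=
  eigenvalue A a /\ (forall b, eigenvalue A b -> a <= b).

(* An edge between S and its complement is listed with its end in S first.    *)
Definition edge_boundary (W : finType) (e : rel W) (S : {set W}) : {set W * W} :=
  [set p | [&& p.1 \in S, p.2 \notin S & e p.1 p.2]].

Definition klein_vertex : finType := ('I_4 * 'I_3)%type.

(* The class of the lattice point (x, y), for x <= 4 and y <= 3.              *)
Definition klein_pt (x y : nat) : klein_vertex :=
  if y == 3 then (inZp (4 - x), inZp 0) else (inZp x, inZp y).

Definition klein_lower (x y : nat) : {set klein_vertex} :=
  [set klein_pt x y; klein_pt x.+1 y; klein_pt x.+1 y.+1].

Definition klein_upper (x y : nat) : {set klein_vertex} :=
  [set klein_pt x y; klein_pt x y.+1; klein_pt x.+1 y.+1].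

Definition klein_bottle : {set {set klein_vertex}} :=
  [set A | (A != set0) && [exists x : 'I_4, exists y : 'I_3,
             (A \subset klein_lower x y) || (A \subset klein_upper x y)]].

(* The connected sum of X and Y along their 2-simplices t and s; each vertex  *)
(* v of s is identified with the vertex f v of t, where f @: s = t.           *)
Section ConnectedSum.
Variables (T T' : finType) (X : {set {set T}}) (Y : {set {set T'}}).
Variables (t : {set T}) (s : {set T'}) (f : T' -> T).

Definition glue (v : T') : T + T' := if v \in s then inl (f v) else inr v.

Definition connected_sum : {set {set (T + T')}} :=
  [set [set inl x | x in A] | A : {set T} in X :\ t]
  :|: [set [set glue v | v in B] | B : {set T'} in Y :\ s].

End ConnectedSum.

(* From here on [set _ | _] and set0 are those of classical_sets.             *)
From mathcomp Require Import all_classical all_reals all_analysis.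

(* The infimum of a finite family, hence its minimum when #|W| > 1.           *)
Definition cheeger (R : realType) (W : finType) (e : rel W) : R :=
  inf [set r | exists S : {set W}, [/\ (0 < #|S|)%N, (2 * #|S| <= #|W|)%N &
                 r = #|edge_boundary e S|%:R / #|S|%:R]]%classic.

Definition h_vol (R : realType) (T : finType) (X : {set {set T}}) : R :=
  cheeger R (dual_graph X).

(* Main.v *)
Require Import Defs.
From mathcomp Require Import all_boot all_order all_algebra.
From mathcomp Require Import complex zify ring lra.

(* Expansion: adding or removing the boundedly many triangles of K changes    *)
(* the size of a vertex set S of the dual graph, and its edge boundary, by    *)
(* at most a constant, so that |E(S, S^c)| >= c |S| - a with a independent of *)
(* k; since the dual graph is connected also |E(S, S^c)| >= 1, and the two    *)
(* bounds give |E(S, S^c)| >= c |S| / (1 + a).  Connectedness holds because   *)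
(* K minus a triangle has a connected dual graph and takes over the role of   *)
(* the removed triangle t of L_k.                                             *)
(* Eigenvalue: orient L_k and let x be the 2-chain with coefficients +1 or -1 *)
(* on L_k \ t and 0 on K \ s.  Its boundary is supported on the three edges   *)
(* of t, so the Rayleigh quotient of x is at most 3 / (n_k - 1), where n_k is *)
(* the number of triangles of L_k.                                            *)

Set Implicit Arguments.
Unset Strict Implicit.
Unset Printing Implicit Defensive.

Import Order.TTheory GRing.Theory Num.Theory.

(** * Triangles around an edge of a closed surface *)

(** Both halves compare the connected sum with the growing surface, from which it differs by a
    bounded piece.

    For the expansion, [connected_sum_expander] replaces a set [S] of triangles of the sum by its
    trace on the orientable side. If [m] is the number of triangles of the Klein bottle, the trace
    loses at most [m] triangles ([card_left_part]), and its boundary exceeds that of [S] by at most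
    the degree of [t] ([left_part_boundary]), which is at most 3 ([degree_le3]).
    [connected_sum_connected] provides one boundary edge, which absorbs these additive errors and
    yields the constant c / (4 + 2cm). About the Klein bottle, finite checks by computation suffice.

    For the eigenvalue, an orientation is a 2-cycle ([oriented_boundary]). Without its term at [t]
    it has squared norm n - 1, for n triangles, and a boundary of squared norm at most 3
    ([punctured_chain_boundary]). By [gram_smallest_eigenvalue] the smallest eigenvalue lies between
    0 and 3 / (n - 1). *)

Lemma next_neq (T : eqType) (c : seq T) (x : T) :
  uniq c -> (1 < size c)%N -> x \in c -> next c x != x.
Proof.
move=> Uc sz_c c_x; case: (rot_to c_x) => i p rot_c.
rewrite -(next_rot i) // rot_c; move: Uc sz_c.
rewrite -(rot_uniq i) -(size_rot i) rot_c; case: p {rot_c} => // y p /=.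
by rewrite !inE negb_or eqxx => /andP[/andP[]]; rewrite eq_sym.
Qed.

Lemma next_neq_prev (T : eqType) (c : seq T) (x : T) :
  uniq c -> (2 < size c)%N -> x \in c -> next c x != prev c x.
Proof.
move=> Uc sz_c c_x; apply: contraL (sz_c) => /eqP nx_px.
case: (rot_to c_x) => i p rot_c; move: nx_px.
rewrite -(next_rot i) // -(prev_rot i) //; move: Uc sz_c.
rewrite -(rot_uniq i) -(size_rot i) rot_c.
case: p {rot_c} => [|y [|z p]] //= /and3P[].
rewrite !inE !negb_or !eqxx => /and3P[/negPf x_y /negPf x_z /negPf x_p].
case/andP=> y_z y_p _ _.
(* With the cycle rotated to x :: y :: z :: p, the successor of [x] is [y] and its predecessor is
   the last element of z :: p. *)
have last_p w q : x \notin q -> prev_at x x w q \in w :: q.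
  elim: q w => [|w' q IHq] w /=; first by rewrite eqxx mem_head.
  rewrite inE negb_or => /andP[/negPf-> /(IHq w')]; rewrite !inE.
  by case/orP=> ->; rewrite !orbT.
rewrite x_y x_z => y_last; have := last_p z p; rewrite -y_last inE (negPf y_z).
by rewrite (negPf y_p) x_p => /(_ isT).
Qed.

Section ClosedSurface.
Variables (T : finType) (X : {set {set T}}).
Hypothesis surfX : closed_surface X.

Lemma surface_subset (A B : {set T}) :
  A \in X -> B \subset A -> B != set0 -> B \in X.
Proof. by case: surfX => -[_ downX] *; apply: downX; eauto. Qed.

(** The triangles through the edge {u, v} correspond to the edges through [v] in the link of [u].
    This link is a circle [c], on which [v] has exactly the two neighbours [next c v] and
    [prev c v]. *)
Lemma edge_triangles (E : {set T}) : E \in simplices X 1 ->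
  #|[set A in simplices X 2 | E \subset A]| = 2.
Proof.
rewrite inE => /andP[XE /cards2P [u [v [u'v defE]]]].
have [_ _ _ linkX] := surfX.
have sub1E w : w \in E -> [set w] \in X.
  move=> Ew; apply: surface_subset XE _ _; first by rewrite sub1set.
  by apply/set0Pn; exists w; rewrite inE.
have Eu : u \in E by rewrite defE !inE eqxx.
have Ev : v \in E by rewrite defE !inE eqxx orbT.
have [c [Uc sz_c defY]] := linkX u (sub1E u Eu).
have c_v : v \in c.
  have: [set v] \in vertex_link X u.
    by rewrite !inE u'v -defE XE sub1E.
  rewrite defY => /setUP[] /imsetP[x c_x] /setP/(_ v).
    by rewrite !inE eqxx => /esym/eqP->.
  by rewrite !inE eqxx => /esym/orP[]/eqP->; rewrite ?mem_next.
have pair_link w : w != v ->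
    ([set v; w] \in vertex_link X u) = (w == next c v) || (w == prev c v).
  move=> v'w; rewrite defY inE.
  have /negPf-> : [set v; w] \notin [set [set x] | x in c].
    apply/imsetP=> -[x _] /(congr1 (fun A : {set T} => #|A|)).
    by rewrite cards2 cards1 eq_sym v'w.
  apply/imsetP/orP => [[x c_x] /setP eq_vw | [/eqP-> | /eqP->]].
  - have := eq_vw v; rewrite !inE eqxx => /esym/orP[]/eqP eq_v.
      have := eq_vw w; rewrite !inE eqxx orbT -eq_v (negPf v'w) /= => /esym->.
      by left.
    have := eq_vw w; rewrite !inE eqxx orbT -eq_v (negPf v'w) orbF.
    move/esym/eqP->.
    by right; rewrite eq_v prev_next.
  - by exists v.
  by exists (prev c v); rewrite ?mem_prev // next_prev // setUC.
have next_v : next c v != v by apply: next_neq => //; apply: ltnW.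
have prev_v : prev c v != v.
  apply: contraNneq next_v => {1}<-; exact/eqP/next_prev.
have linkP w : w != v -> [set v; w] \in vertex_link X u ->
    u |: [set v; w] \in [set A in simplices X 2 | E \subset A].
  move=> v'w; rewrite !inE negb_or => /and3P[_ /andP[_ u'w] ->].
  rewrite cardsU1 !inE negb_or u'v u'w cards2 (eq_sym v) v'w defE.
  by rewrite setUA subsetUl.
have -> : [set A in simplices X 2 | E \subset A] =
    [set u |: [set v; next c v]; u |: [set v; prev c v]].
  apply/setP=> A; apply/idP/idP; last first.
    by case/set2P=> ->; apply: linkP; rewrite ?pair_link ?eqxx ?orbT.
  rewrite inE inE => /andP[/andP[XA cardA] sEA].
  have Au : u \in A by apply: (subsetP sEA).
  have Av : v \in A by apply: (subsetP sEA).
  have : #|A :\: E| == 1%N.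
    by rewrite cardsD (setIidPr sEA) (eqP cardA) defE cards2 u'v.
  case/cards1P => w defA.
  have /setDP[Aw] : w \in A :\: E by rewrite defA set11.
  rewrite defE !inE negb_or => /andP[w'u w'v].
  have {}defA : A = u |: [set v; w].
    apply/setP=> x; have /setP/(_ x) := defA; rewrite defE !inE.
    case: (x =P u) => [->|_] /=; first by rewrite Au.
    by case: (x =P v) => [->|_] /=; first by rewrite Av.
  have : [set v; w] \in vertex_link X u.
    rewrite !inE -defA XA negb_or u'v eq_sym w'u !andbT /=.
    apply: surface_subset XA _ _; first by rewrite defA subsetUr.
    by apply/set0Pn; exists v; rewrite !inE eqxx.
  by rewrite pair_link // defA => /orP[]/eqP->; rewrite ?eqxx ?orbT.
have u'next : next c v != u.
  have := pair_link _ next_v; rewrite eqxx !inE negb_or.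
  by case/and3P=> _ /andP[_]; rewrite eq_sym.
rewrite cards2; case: eqP => // /setP/(_ (next c v)); rewrite !inE eqxx !orbT.
by rewrite (negPf u'next) (negPf next_v) (negPf (next_neq_prev Uc sz_c c_v)).
Qed.
End ClosedSurface.

(** * The triangles of the Klein bottle *)

(** Adjacency in the dual graph, moved from the subtype [dual_vertex] to plain sets so that
    different complexes can be compared. [dual_graphE] identifies the two when the intersections of
    adjacent triangles belong to the complex. *)
Definition face_adj (T : finType) (X : {set {set T}}) : rel {set T} :=
  fun A B => [&& A \in simplices X 2, B \in simplices X 2, A != B
                 & 1 < #|A :&: B|].

(** Sequences rather than sets, so that the checks below can be run by computation. *)
Definition klein_tri (p : nat * nat * bool) : seq klein_vertex :=
  let: (x, y, up) := p in
  [:: klein_pt x y; if up then klein_pt x y.+1 else klein_pt x.+1 y;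
      klein_pt x.+1 y.+1].

(* A Hamiltonian cycle of the dual graph: the removal of any triangle leaves  *)
(* a path, so that the dual graph stays connected.                            *)
Definition klein_cycle : seq (nat * nat * bool) :=
  let lo x y := (x, y, false) in let up x y := (x, y, true) in
  [:: lo 0 0; up 0 0; lo 0 1; up 0 1; lo 0 2; up 1 2; lo 2 0; up 2 0;
      lo 1 0; up 1 0; lo 1 1; up 1 1; lo 1 2; up 2 2; lo 2 2; up 2 1;
      lo 2 1; up 3 1; lo 3 1; up 3 0; lo 3 0; up 0 2; lo 3 2; up 3 2].

Definition klein_face p : {set klein_vertex} := [set v in klein_tri p].

Lemma klein_tri_uniq : all (fun p => uniq (klein_tri p)) klein_cycle.
Proof. by vm_compute. Qed.

Lemma klein_cycle_share :
  cycle (fun p q => count [in klein_tri q] (klein_tri p) == 2) klein_cycle.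
Proof. by vm_compute. Qed.

Lemma klein_cycle_neq :
  pairwise (fun p q => ~~ all [in klein_tri q] (klein_tri p)) klein_cycle.
Proof. by vm_compute. Qed.

(** Every edge of a triangle lies in another one: a triangle [q] that has exactly two vertices in
    common with [p] differs from [p]. *)
Lemma klein_cycle_edges :
  all (fun p => allrel (fun u v => (u == v) ||
         has (fun q => [&& u \in klein_tri q, v \in klein_tri q
              & count [in klein_tri q] (klein_tri p) == 2])
             klein_cycle) (klein_tri p) (klein_tri p)) klein_cycle.
Proof. by vm_compute. Qed.

Lemma klein_subset (A B : {set klein_vertex}) :
  A \in klein_bottle -> B \subset A -> B != set0 -> B \in klein_bottle.
Proof.
rewrite !inE => /andP[_ /existsP[x /existsP[y sA]]] sBA -> /=.
apply/existsP; exists x; apply/existsP; exists y.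
by case/orP: sA => sA; rewrite (subset_trans sBA sA) ?orbT.
Qed.

Lemma card_klein_face p : p \in klein_cycle -> #|klein_face p| = 3.
Proof.
move=> c_p; rewrite cardsE (card_uniqP _) ?(allP klein_tri_uniq) //.
by case: p c_p => -[].
Qed.

Lemma klein_faces_uniq : uniq [seq klein_face p | p <- klein_cycle].
Proof.
rewrite uniq_pairwise pairwise_map.
apply: sub_pairwise klein_cycle_neq => p q /=.
apply: contraNneq => /setP eq_pq; apply/allP=> v p_v.
by have := eq_pq v; rewrite !inE p_v => <-.
Qed.

(** A simplex with three vertices contained in a triangle of the subdivision equals it, and
    [klein_cycle] visits all 24 triangles. *)
Lemma klein_facesE :
  simplices klein_bottle 2 =i [seq klein_face p | p <- klein_cycle].
Proof.
have lowE x y : klein_lower x y = klein_face (x, y, false).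
  by apply/setP=> v; rewrite !inE orbA.
have upE x y : klein_upper x y = klein_face (x, y, true).
  by apply/setP=> v; rewrite !inE orbA.
have cycE x y b : x < 4 -> y < 3 -> (x, y, b) \in klein_cycle.
  by case: x y b => [|[|[|[|]]]] // [|[|[|]]] // [].
move=> A; apply/idP/mapP => [|[[[x y] b] c_p ->]].
  rewrite !inE => /andP[/andP[_ /existsP[x /existsP[y sA]]] /eqP cardA].
  rewrite lowE upE in sA; case/orP: sA => sA.
    exists (x : nat, y : nat, false); rewrite ?cycE //; apply/eqP.
    by rewrite eqEcard sA cardA card_klein_face ?cycE.
  exists (x : nat, y : nat, true); rewrite ?cycE //; apply/eqP.
  by rewrite eqEcard sA cardA card_klein_face ?cycE.
have bnd : all (fun p => (p.1.1 < 4) && (p.1.2 < 3)) klein_cycle by [].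
have /andP[/= ltx lty] := allP bnd _ c_p.
rewrite !inE card_klein_face // -cards_eq0 card_klein_face //= andbT.
apply/existsP; exists (Ordinal ltx); apply/existsP; exists (Ordinal lty).
by rewrite lowE upE /=; case: b {c_p}; rewrite subxx ?orbT.
Qed.

Lemma card_klein_faceI p q : p \in klein_cycle ->
  #|klein_face p :&: klein_face q| = count [in klein_tri q] (klein_tri p).
Proof.
move=> c_p; rewrite -size_filter.
rewrite -(card_uniqP (filter_uniq _ (allP klein_tri_uniq p c_p))).
by apply: eq_card => v; rewrite !inE mem_filter andbC.
Qed.

Lemma klein_face_neq p q : p \in klein_cycle ->
  count [in klein_tri q] (klein_tri p) == 2 -> klein_face p != klein_face q.
Proof.
move=> c_p /eqP; rewrite -card_klein_faceI // => cardI.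
by apply: contra_eq_neq cardI => <-; rewrite setIid card_klein_face.
Qed.

Lemma klein_faces_cycle :
  cycle (face_adj klein_bottle) [seq klein_face p | p <- klein_cycle].
Proof.
rewrite cycle_map; have c_cyc : all [in klein_cycle] klein_cycle by apply/allP.
apply: sub_in_cycle c_cyc klein_cycle_share => p q c_p c_q /= share_pq.
rewrite /face_adj !klein_facesE !map_f //= klein_face_neq //=.
by rewrite card_klein_faceI // (eqP share_pq).
Qed.

Lemma klein_edge_triangle (B E : {set klein_vertex}) :
  B \in simplices klein_bottle 2 -> E \subset B -> #|E| = 2 ->
  exists2 B', B' \in simplices klein_bottle 2 & (B' != B) && (E \subset B').
Proof.
rewrite klein_facesE => /mapP[p c_p ->] /subsetP sEB.
case/eqP/cards2P=> u [v [u'v defE]].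
have p_E w : w \in E -> w \in klein_tri p by move/sEB; rewrite inE.
have /allP/(_ p c_p)/allrelP/(_ u v) := klein_cycle_edges.
rewrite (negPf u'v) !p_E ?defE ?inE ?eqxx ?orbT //.
move=> /(_ isT isT) /hasP[q c_q /and3P[q_u q_v share_pq]].
exists (klein_face q); first by rewrite klein_facesE map_f.
by rewrite eq_sym klein_face_neq // subUset !sub1set !inE q_u.
Qed.

(** * Adjacency of triangles *)

(** A cycle without [s] is a path, and a predicate preserved by the symmetric relation [e] is
    constant along a path. Connectedness is expressed through such predicates. *)
Lemma cycle_pred_const (T : eqType) (e : rel T) (c : seq T) (s : T)
    (P : pred T) :
  uniq c -> cycle e c -> s \in c -> symmetric e ->
  {in [pred x in c | x != s] &, forall x y, e x y -> P x -> P y} ->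
  {in [pred x in c | x != s] &, forall x y, P x -> P y}.
Proof.
move=> Uc cyc_c c_s sym_e eP; case: (rot_to c_s) => i p rot_c.
have pE x : (x \in [pred x in c | x != s]) = (x \in p).
  rewrite inE -(mem_rot i) rot_c inE; move: Uc; rewrite -(rot_uniq i) rot_c /=.
  case/andP=> s_p _; case: eqP => [->|_].
    by rewrite (negPf s_p).
  by rewrite andbT.
have: sorted e p.
  move: cyc_c; rewrite -(rot_cycle i) rot_c /= rcons_path.
  by case/andP=> /path_sorted.
have p_p : all [in p] p by apply/allP.
have eP2 : {in p &, subrel e (fun x y => P x == P y)}.
  move=> x y p_x p_y /= exy; apply/eqP.
  apply/idP/idP; apply: eP; rewrite ?pE //.
  by rewrite sym_e.
move/(sub_in_sorted eP2 p_p); rewrite sorted_pairwise; last first.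
  by move=> y2 y1 y3 /eqP-> /eqP->.
rewrite pairwise_all2rel; last 2 first.
- by move=> y; apply: eqxx.
- by move=> y1 y2; apply: eq_sym.
move/allrelP=> eq_P x y; rewrite !pE => p_x p_y.
by rewrite (eqP (eq_P _ _ p_x p_y)).
Qed.

Section FaceAdj.
Variables (T : finType) (X : {set {set T}}).
Implicit Types A B E : {set T}.

Lemma face_adj_sym : symmetric (face_adj X).
Proof. by move=> A B; rewrite /face_adj andbCA setIC eq_sym. Qed.

Lemma face_adj_card A B : face_adj X A B -> #|A :&: B| = 2.
Proof.
rewrite /face_adj !inE => /and4P[/andP[_ /eqP cA] /andP[_ /eqP cB] A'B cAB].
apply/eqP; rewrite eqn_leq cAB andbT -ltnS -[X in _ < X]cA ltn_neqAle.
rewrite subset_leq_card ?subsetIl // andbT; apply: contraNneq A'B => cI.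
have /eqP eIA : A :&: B == A by rewrite eqEcard subsetIl cI leqnn.
by rewrite eqEcard cA cB leqnn andbT -eIA subsetIr.
Qed.

Lemma edge_face_adj A B E : A \in simplices X 2 -> B \in simplices X 2 ->
  A != B -> E \subset A -> E \subset B -> #|E| = 2 -> face_adj X A B.
Proof.
move=> XA XB A'B sEA sEB cE; rewrite /face_adj XA XB A'B -[X in X < _]/1 -cE.
by rewrite subset_leq_card // subsetI sEA.
Qed.

Hypothesis capX : forall A B, face_adj X A B -> A :&: B \in X.

Lemma dual_graphE (a b : dual_vertex X) :
  dual_graph X a b = face_adj X (val a) (val b).
Proof.
apply/idP/idP => [|adj_ab]; last first.
  have [_ _ a'b _] := and4P adj_ab; apply/andP; split=> //.
  apply/existsP; exists (val a :&: val b).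
  by rewrite inE capX // face_adj_card // subsetIl subsetIr.
case/andP=> a'b /existsP[E /and3P[]]; rewrite inE => /andP[_ /eqP cE] sEa sEb.
exact: (edge_face_adj (valP a) (valP b)) cE.
Qed.

Lemma card_edge_boundary_val (S : {set dual_vertex X}) :
  #|edge_boundary (dual_graph X) S| = #|edge_boundary (face_adj X) (val @: S)|.
Proof.
pose g (p : dual_vertex X * dual_vertex X) := (val p.1, val p.2).
have injg : injective g by move=> [a b] [a' b'] [/val_inj-> /val_inj->].
rewrite -(card_imset _ injg); apply: eq_card => -[A B].
apply/imsetP/idP => [[[a b]]|]; rewrite !inE /=.
  case/and3P=> Sa S'b ab [-> ->]; rewrite !mem_imset //; try exact: val_inj.
  by rewrite Sa S'b -dual_graphE.
case/and3P=> /imsetP[a Sa ->] S'B adj_aB; have [_ XB _ _] := and4P adj_aB.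
exists (a, Sub B XB) => //=; rewrite !inE /= Sa dual_graphE SubK adj_aB andbT.
by apply: contra S'B => Sb; apply/imsetP; exists (Sub B XB); rewrite ?SubK.
Qed.

End FaceAdj.

Section SurfaceAdj.
Variables (T : finType) (X : {set {set T}}).
Hypothesis surfX : closed_surface X.

Lemma surface_cap (A B : {set T}) : face_adj X A B -> A :&: B \in X.
Proof.
move=> adjAB; have [] := and4P adjAB; rewrite !inE => /andP[XA _] _ _ ltI.
by apply: (surface_subset surfX XA); rewrite ?subsetIl // -card_gt0 ltnW.
Qed.

Lemma edge_triangle (A E : {set T}) :
  A \in simplices X 2 -> E \subset A -> #|E| = 2 ->
  exists2 B, B \in simplices X 2 & (B != A) && (E \subset B).
Proof.
move=> XA sEA cE; have XE : E \in simplices X 1.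
  move: XA; rewrite !inE cE eqxx andbT => /andP[XA _].
  by apply: (surface_subset surfX XA); rewrite // -card_gt0 cE.
have := edge_triangles surfX XE; rewrite (cardsD1 A) inE XA sEA => -[].
move/eqP/cards1P=> [B /setP/(_ B)]; rewrite set11 !inE => /and3P[B'A XB sEB].
by exists B; rewrite ?inE // B'A.
Qed.

(** A neighbour is determined by the edge it shares with [A], because only one other triangle
    contains that edge; and [A] has three edges. *)
Lemma degree_le3 (A : {set T}) : A \in simplices X 2 ->
  #|[set B | face_adj X B A]| <= 3.
Proof.
move=> XA; have cA : #|A| = 3 by move: XA; rewrite inE => /andP[_ /eqP].
suff injI : {in [set B | face_adj X B A] &, injective (fun B => B :&: A)}.
  apply: (@leq_trans 'C(#|A|, 2)); last by rewrite cA.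
  rewrite -(card_in_imset injI) -cards_draws; apply: subset_leq_card.
  apply/subsetP=> _ /imsetP[B + ->]; rewrite !inE => adjBA.
  by rewrite subsetIr (face_adj_card adjBA).
move=> B C; rewrite !inE => adjBA adjCA eqI.
have [XB _ B'A _] := and4P adjBA; have [XC _ C'A _] := and4P adjCA.
have XI : B :&: A \in simplices X 1.
  by rewrite inE surface_cap // (face_adj_card adjBA).
have := edge_triangles surfX XI.
rewrite (cardsD1 A) inE XA subsetIr (cardsD1 B).
rewrite in_setD1 inE B'A XB subsetIl => -[] /eqP; rewrite cards_eq0.
move=> /eqP/setP/(_ C).
rewrite !inE C'A eqI subsetIl; move: XC; rewrite inE => -> /=.
by rewrite !andbT => /negbFE/eqP.
Qed.
End SurfaceAdj.

(** * The connected sum *)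

Lemma subset_imset_ex (aT rT : finType) (g : aT -> rT) (C : {set aT})
    (E : {set rT}) :
  E \subset g @: C -> exists2 E0 : {set aT}, E0 \subset C & E = g @: E0.
Proof.
move=> sEC; exists (C :&: g @^-1: E); first exact: subsetIl.
apply/setP=> y; apply/idP/imsetP => [Ey | [x + ->]]; last first.
  by rewrite !inE => /andP[].
have /imsetP[x Cx def_y] := subsetP sEC y Ey.
by exists x; rewrite // !inE Cx -def_y.
Qed.

Section ConnectedSum.
Variables (T T' : finType) (X : {set {set T}}) (Y : {set {set T'}}).
Variables (t : {set T}) (s : {set T'}) (f : T' -> T).
Hypotheses (Xt : t \in simplices X 2) (Ys : s \in simplices Y 2).
Hypothesis f_glue : f @: s = t.

Local Notation U := (connected_sum X Y t s f).
Local Notation left A := ([set inl x | x in A] : {set T + T'}).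
Local Notation right B := ([set glue s f v | v in B] : {set T + T'}).

(** Since [s] and its image [t] both have three elements, [f] is injective on [s]. *)
Lemma glue_inj : injective (glue s f).
Proof.
have f_inj : {in s &, injective f}.
  apply/imset_injP; rewrite f_glue.
  by move: Xt Ys; rewrite !inE => /andP[_ /eqP->] /andP[_ /eqP->].
move=> u v; rewrite /glue; case: ifP => s_u; case: ifP => s_v // [] //.
exact: f_inj.
Qed.

Lemma card_left (A : {set T}) : #|left A| = #|A|.
Proof. by rewrite card_imset //; apply: inl_inj. Qed.

Lemma card_right (B : {set T'}) : #|right B| = #|B|.
Proof. by rewrite card_imset //; apply: glue_inj. Qed.

Lemma right_edge (E : {set T'}) : E \subset s -> right E = left (f @: E).
Proof.
move=> sEs; rewrite -imset_comp; apply: eq_in_imset => v Ev.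
by rewrite /glue (subsetP sEs _ Ev).
Qed.

Lemma connected_sum_simplices (p : nat) (A : {set T + T'}) :
  A \in simplices U p =
  (A \in [set left B | B : {set T} in simplices X p :\ t])
  || (A \in [set right B | B : {set T'} in simplices Y p :\ s]).
Proof.
rewrite inE; apply/idP/orP => [/andP[/setUP[]/imsetP[B]] | ].
- rewrite !inE => /andP[B't XB] ->; rewrite card_left => cB; left.
  by apply: imset_f; rewrite !inE B't XB.
- rewrite !inE => /andP[B's YB] ->; rewrite card_right => cB; right.
  by apply: imset_f; rewrite !inE B's YB.
case=> /imsetP[B]; rewrite !inE => /and3P[B't XB cB] ->.
  by rewrite card_left cB andbT imset_f //= !inE B't.
by rewrite card_right cB andbT orbC imset_f //= !inE B't.
Qed.

Lemma leftI (A B : {set T}) : left A :&: left B = left (A :&: B).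
Proof. by rewrite imsetI // => x y _ _ []. Qed.

Lemma rightI (A B : {set T'}) : right A :&: right B = right (A :&: B).
Proof. by rewrite imsetI // => x y _ _; apply: glue_inj. Qed.

Lemma left_face (A : {set T}) :
  A \in simplices X 2 :\ t -> left A \in simplices U 2.
Proof. by move=> XA; rewrite connected_sum_simplices imset_f. Qed.

Lemma right_face (B : {set T'}) :
  B \in simplices Y 2 :\ s -> right B \in simplices U 2.
Proof. by move=> YB; rewrite connected_sum_simplices orbC imset_f. Qed.

Lemma face_adj_left (A B : {set T}) :
  A \in simplices X 2 :\ t -> B \in simplices X 2 :\ t ->
  face_adj U (left A) (left B) = face_adj X A B.
Proof.
move=> XA XB; rewrite /face_adj !left_face // leftI card_left.
rewrite (inj_eq (imset_inj _)); last exact: inl_inj.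
by case/setD1P: XA => _ ->; case/setD1P: XB => _ ->.
Qed.

Lemma face_adj_right (A B : {set T'}) :
  A \in simplices Y 2 :\ s -> B \in simplices Y 2 :\ s ->
  face_adj U (right A) (right B) = face_adj Y A B.
Proof.
move=> YA YB; rewrite /face_adj !right_face // rightI card_right.
rewrite (inj_eq (imset_inj _)); last exact: glue_inj.
by case/setD1P: YA => _ ->; case/setD1P: YB => _ ->.
Qed.

Hypothesis Xdown : forall A B : {set T},
  A \in X -> B \subset A -> B != set0 -> B \in X.
Hypothesis Ydown : forall A B : {set T'},
  A \in Y -> B \subset A -> B != set0 -> B \in Y.

(** The common edge is a face of a simplex of one summand; having two vertices, it is neither [t]
    nor [s], so it survives in the sum. *)
Lemma connected_sum_cap (A B : {set T + T'}) : face_adj U A B -> A :&: B \in U.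
Proof.
move=> adjAB; have cE := face_adj_card adjAB.
have [UA _ _ _] := and4P adjAB; move: UA (subsetIl A B) cE.
move: (A :&: B) => E; rewrite connected_sum_simplices.
case/orP=> /imsetP[C /setD1P[_]]; rewrite inE => /andP[XC cC] -> sEC cE.
  have [E0 sE0C defE] := subset_imset_ex sEC; rewrite defE card_left in cE *.
  rewrite inE imset_f // !inE; apply/andP; split.
    by apply: contraTneq Xt => <-; rewrite inE cE andbF.
  by apply: (Xdown XC); rewrite // -card_gt0 cE.
have [E0 sE0C defE] := subset_imset_ex sEC; rewrite defE card_right in cE *.
rewrite inE orbC imset_f // !inE; apply/andP; split.
  by apply: contraTneq Ys => <-; rewrite inE cE andbF.
by apply: (Ydown XC); rewrite // -card_gt0 cE.
Qed.

Hypothesis Yedge : forall B E : {set T'}, B \in simplices Y 2 ->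
  E \subset B -> #|E| = 2 ->
  exists2 B', B' \in simplices Y 2 & (B' != B) && (E \subset B').

(** The edge common to [A] and [t] pulls back along [f] to an edge of [s], and the other triangle of
    [Y] on that edge becomes a neighbour of [A] in the sum. *)
Lemma face_adj_across (A : {set T}) : face_adj X A t ->
  exists2 B : {set T'}, B \in simplices Y 2 :\ s &
    face_adj U (left A) (right B).
Proof.
move=> adjAt; have cE := face_adj_card adjAt.
pose E := [set v in s | f v \in A].
have defE : f @: E = A :&: t.
  apply/setP=> x; rewrite -f_glue inE; apply/imsetP/andP => [[v + ->]|[Ax]].
    by rewrite inE => /andP[s_v Afv]; rewrite Afv imset_f.
  by case/imsetP=> v s_v def_x; exists v; rewrite // inE s_v -def_x.
have sEs : E \subset s by apply/subsetP=> v; rewrite inE => /andP[].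
have cE' : #|E| = 2 by rewrite -cE -defE -card_right right_edge // card_left.
have [B YB /andP[B's sEB]] := Yedge Ys sEs cE'.
have XA : A \in simplices X 2 :\ t.
  by case/and4P: adjAt => XA _ A't _; apply/setD1P.
exists B; first exact/setD1P.
apply: (@edge_face_adj _ _ _ _ (right E)).
- exact: left_face.
- by apply: right_face; apply/setD1P.
(* If the two images were equal, every vertex of [B] would be glued, hence in [s], and so [B] would
   be [s]. *)
- apply: contraNneq B's => eqAB; rewrite eqEcard.
  have -> : #|s| <= #|B|.
    by move: Ys YB; rewrite !inE => /andP[_ /eqP->] /andP[_ /eqP->].
  rewrite andbT; apply/subsetP=> v Bv.
  have: glue s f v \in left A by rewrite eqAB imset_f.
  by rewrite /glue; case: ifP => // _ /imsetP[].
- by rewrite right_edge // imsetS // defE subsetIl.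
- by rewrite imsetS.
by rewrite card_right.
Qed.

Lemma card_connected_sum :
  #|simplices U 2| <= #|simplices X 2| + #|simplices Y 2|.
Proof.
set LX := [set left A | A : {set T} in simplices X 2 :\ t].
set RY := [set right B | B : {set T'} in simplices Y 2 :\ s].
apply: (@leq_trans (#|LX| + #|RY|)).
  apply: leq_trans (leq_card_setU _ _); apply/subset_leq_card/subsetP=> A.
  by rewrite connected_sum_simplices inE.
by apply: leq_add; apply: leq_trans (leq_imset_card _ _) _;
   rewrite subset_leq_card // subsetDl.
Qed.

Section Boundary.
Variable S : {set {set T + T'}}.
Hypothesis sSU : S \subset simplices U 2.

Let SX := [set A in simplices X 2 :\ t | left A \in S].

Lemma card_left_part : #|S| <= #|SX| + #|simplices Y 2|.
Proof.
set LX := [set left A | A : {set T} in SX].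
set RY := [set right B | B : {set T'} in simplices Y 2 :\ s].
apply: (@leq_trans (#|LX| + #|RY|)).
  apply: leq_trans (leq_card_setU _ _); apply/subset_leq_card/subsetP=> A SA.
  have:= subsetP sSU A SA; rewrite connected_sum_simplices inE.
  case/orP=> /imsetP[B B_in defA]; last by rewrite defA orbC imset_f.
  by rewrite defA imset_f // inE B_in -defA.
apply: leq_add; apply: leq_trans (leq_imset_card _ _) _ => //.
by rewrite subset_leq_card // subsetDl.
Qed.

(** A boundary edge of [SX] whose outer end is not [t] maps to a boundary edge of [S]; the others
    come from neighbours of [t]. *)
Lemma left_part_boundary :
  #|edge_boundary (face_adj X) SX|
    <= #|edge_boundary (face_adj U) S| + #|[set A | face_adj X A t]|.
Proof.
pose g (p : {set T} * {set T}) := (left p.1, left p.2).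
have left_inj := imset_inj (@inl_inj T T').
have inj_g : injective g.
  by move=> [A B] [A' B'] [/left_inj-> /left_inj->].
pose N := [set (A, t) | A : {set T} in [set A | face_adj X A t]].
rewrite -(cardsID N) addnC; apply: leq_add; last first.
  apply: leq_trans (subset_leq_card (subsetIr _ _)) _.
  exact: leq_imset_card.
rewrite -(card_imset _ inj_g); apply/subset_leq_card/subsetP.
move=> _ /imsetP[[A B] + ->].
rewrite in_setD 2!inE => /andP[N'AB /and3P[SA S'B adjAB]].
have [_ XB _ _] := and4P adjAB; move: SA S'B; rewrite /= ![_ \in SX]inE.
case/andP=> XA SA.
have B't : B != t.
  apply: contraNneq N'AB => eqBt; move: adjAB; rewrite eqBt => adjAt.
  by rewrite imset_f // inE.
have XB' : B \in simplices X 2 :\ t by apply/setD1P.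
by rewrite XB' inE /= SA face_adj_left // adjAB => ->.
Qed.

Hypothesis Xconn : forall Z : {set {set T}}, Z \subset simplices X 2 ->
  edge_boundary (face_adj X) Z = set0 -> Z = set0 \/ Z = simplices X 2.
Hypothesis Yconn : forall P : pred {set T'},
  {in simplices Y 2 :\ s &, forall A B, face_adj Y A B -> P A -> P B} ->
  {in simplices Y 2 :\ s &, forall A B, P A -> P B}.

(** A set [S] without boundary contains all or none of the triangles coming from [Y]. Contracting
    these to the single triangle [t] gives a set [Z] without boundary in [X], where
    [face_adj_across] handles the neighbours of [t]. Then [Z] is empty or everything, and so is
    [S]. *)
Lemma connected_sum_connected :
  edge_boundary (face_adj U) S = set0 -> S = set0 \/ S = simplices U 2.
Proof.
move=> bS0; have closedS A B : face_adj U A B -> A \in S -> B \in S.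
  move=> adjAB SA; apply: contraT => S'B.
  by have /setP/(_ (A, B)) := bS0; rewrite !inE /= SA S'B adjAB.
pose P := [pred B : {set T'} | right B \in S].
have PY : {in simplices Y 2 :\ s &, forall A B, P A -> P B}.
  apply: Yconn => A B YA YB adjAB; apply: closedS.
  by rewrite face_adj_right.
pose b := [exists B in simplices Y 2 :\ s, P B].
have bE B : B \in simplices Y 2 :\ s -> P B = b.
  move=> YB; apply/idP/existsP => [PB | [C /andP[YC PC]]]; last exact: PY PC.
  by exists B; rewrite YB.
(* In Z the triangle t stands for all the triangles of Y other than s.        *)
pose Z := if b then t |: SX else SX.
have ZE A : A \in simplices X 2 ->
    (A \in Z) = (if A == t then b else left A \in S).
  move=> XA; rewrite /Z; case: (A =P t) => [->|/eqP A't].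
    by case: (b); rewrite !inE eqxx.
  by case: (b); rewrite !inE A't ?(negPf A't) /=; move: XA; rewrite inE => ->.
have across A : face_adj X A t -> (left A \in S) = b.
  move=> /face_adj_across[B YB adjAB]; rewrite -(bE B YB).
  by apply/idP/idP; apply: closedS; rewrite // face_adj_sym.
have sZX : Z \subset simplices X 2.
  have sSX : SX \subset simplices X 2.
    by apply/subsetP=> A; rewrite inE => /andP[/setD1P[]].
  by rewrite /Z; case: (b); rewrite // subUset sub1set Xt.
have bZ0 : edge_boundary (face_adj X) Z = set0.
  apply/setP=> -[A B]; rewrite [RHS]inE inE /=; apply/and3P=> -[ZA Z'B adjAB].
  have [XA XB A'B _] := and4P adjAB; move: ZA Z'B; rewrite !ZE //.
  case: eqP adjAB => [->|/eqP A't]; case: eqP => [->|/eqP B't] adjAB.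
  - by move=> ->.
  - by rewrite (across B) => [->|]; last rewrite face_adj_sym.
  - by rewrite (across A adjAB) => ->.
  move=> SA /negP[]; apply: closedS SA; rewrite face_adj_left //; exact/setD1P.
have [Z0|ZX] := Xconn sZX bZ0.
  have b0 : b = false by have := ZE t Xt; rewrite Z0 inE eqxx.
  left; apply/eqP; rewrite -subset0; apply/subsetP=> A SA.
  have := subsetP sSU A SA; rewrite connected_sum_simplices.
  case/orP=> /imsetP[B B_in defA]; move: SA; rewrite defA.
    have [B't XB] := setD1P B_in; have := ZE B XB.
    by rewrite Z0 inE (negPf B't) => <-.
  by have := bE B B_in; rewrite b0 /= => ->.
have b1 : b by have := ZE t Xt; rewrite ZX Xt eqxx.
right; apply/eqP; rewrite eqEsubset sSU; apply/subsetP=> A.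
rewrite connected_sum_simplices => /orP[]/imsetP[B B_in ->].
  have [B't XB] := setD1P B_in; have := ZE B XB.
  by rewrite ZX XB (negPf B't) => <-.
by have := bE B B_in; rewrite b1.
Qed.

End Boundary.
End ConnectedSum.

(** * Expansion of the connected sum *)

Section Expander.
Variables (R : realFieldType) (T : finType) (X : {set {set T}}) (c : R).
Local Notation F := (simplices X 2).
Hypothesis expX : forall Z : {set {set T}}, Z \subset F -> 2 * #|Z| <= #|F| ->
  (c * #|Z|%:R <= #|edge_boundary (face_adj X) Z|%:R)%R.

(** A set and its complement have the same boundary up to swapping the ends of edges, so the
    expansion bound applies to the smaller of the two. This is needed because the trace of a small
    set on [X] may exceed half of [X]. *)
Lemma expander_minn (Z : {set {set T}}) : Z \subset F ->
  (c * (minn #|Z| (#|F| - #|Z|))%:R <= #|edge_boundary (face_adj X) Z|%:R)%R.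
Proof.
move=> sZF; case: (leqP #|Z| (#|F| - #|Z|)) => cZ.
  by apply: expX => //; lia.
have cD : #|F :\: Z| = #|F| - #|Z| by rewrite cardsD (setIidPr sZF).
pose g (p : {set T} * {set T}) := (p.2, p.1).
have inj_g : injective g by move=> [A B] [A' B'] [-> ->].
have -> : #|edge_boundary (face_adj X) Z|
    = #|edge_boundary (face_adj X) (F :\: Z)|.
  rewrite -(card_imset _ inj_g); apply: eq_card => -[A B].
  apply/imsetP/idP => [[[A' B'] + [-> ->]]|].
    rewrite !inE /= => /and3P[ZA Z'B adjAB]; have [_ XB _ _] := and4P adjAB.
    by move: XB; rewrite inE face_adj_sym adjAB ZA Z'B => ->.
  rewrite !inE /= => /and3P[/andP[Z'A XA] nDB adjAB]; exists (B, A) => //.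
  rewrite !inE /= face_adj_sym adjAB Z'A; have [_ XB _ _] := and4P adjAB.
  by move: XB; rewrite inE => XB; move: nDB; rewrite XB andbT negbK => ->.
by rewrite -cD; apply: expX; [apply: subsetDl | lia].
Qed.

Lemma expander_connected (Z : {set {set T}}) : (0 < c)%R -> Z \subset F ->
  edge_boundary (face_adj X) Z = set0 -> Z = set0 \/ Z = F.
Proof.
move=> c_gt0 sZF bZ0; have := expander_minn sZF.
rewrite bZ0 cards0 pmulr_rle0 // lern0 => /eqP min0.
have [Z0|F0] : #|Z| = 0 \/ #|F| <= #|Z| by lia.
  by left; apply: cards0_eq.
by right; apply/eqP; rewrite eqEcard sZF.
Qed.

End Expander.

Lemma connected_sum_expander (R : realFieldType) (T T' : finType)
    (X : {set {set T}}) (Y : {set {set T'}}) (t : {set T}) (s : {set T'})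
    (f : T' -> T) (c : R) (d : nat) :
  let U := connected_sum X Y t s f in
  t \in simplices X 2 -> s \in simplices Y 2 -> f @: s = t ->
  (forall A B : {set T'}, A \in Y -> B \subset A -> B != set0 -> B \in Y) ->
  (forall B E : {set T'}, B \in simplices Y 2 -> E \subset B -> #|E| = 2 ->
    exists2 B', B' \in simplices Y 2 & (B' != B) && (E \subset B')) ->
  (forall P : pred {set T'},
    {in simplices Y 2 :\ s &, forall A B, face_adj Y A B -> P A -> P B} ->
    {in simplices Y 2 :\ s &, forall A B, P A -> P B}) ->
  #|[set A | face_adj X A t]| <= d ->
  (0 < c)%R ->
  (forall Z : {set {set T}}, Z \subset simplices X 2 ->
    2 * #|Z| <= #|simplices X 2| ->
    (c * #|Z|%:R <= #|edge_boundary (face_adj X) Z|%:R)%R) ->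
  forall S : {set {set T + T'}}, S \subset simplices U 2 -> 0 < #|S| ->
    2 * #|S| <= #|simplices U 2| ->
  (c / (1 + d%:R + 2 * c * #|simplices Y 2|%:R) * #|S|%:R
    <= #|edge_boundary (face_adj U) S|%:R)%R.
Proof.
move=> U Xt Ys f_glue Ydown Yedge Yconn degt c_gt0 expX S sSU S_gt0 leSU.
set m := #|simplices Y 2|; set E := #|edge_boundary _ S|.
set SX := [set A in simplices X 2 :\ t | [set inl x | x in A] \in S].
have sSX : SX \subset simplices X 2.
  by apply/subsetP=> A; rewrite inE => /andP[/setD1P[]].
have leSX : #|SX| <= #|S|.
  rewrite -(card_imset _ (imset_inj (@inl_inj T T'))) subset_leq_card //.
  by apply/subsetP=> _ /imsetP[A + ->]; rewrite inE => /andP[].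
(* The bound by the complement of [SX] comes from 2|S| <= |U| <= |X| + m, counting triangles,
   together with |SX| <= |S|. *)
have leS : #|S| <= minn #|SX| (#|simplices X 2| - #|SX|) + 2 * m.
  have := card_left_part Xt Ys f_glue sSU.
  have := card_connected_sum Xt Ys f_glue.
  by rewrite -/U -/m -/SX; lia.
have E_gt0 : 0 < E.
  rewrite card_gt0; apply/eqP=> bS0.
  case: (connected_sum_connected Xt Ys f_glue Yedge sSU _ Yconn bS0).
  - by move=> Z sZ; apply: (expander_connected expX).
  - by move=> S0; rewrite S0 cards0 in S_gt0.
  by move=> SU; move: leSU; rewrite -SU; lia.
have leE := left_part_boundary Xt Ys f_glue S; rewrite -/SX -/E in leE.
have leSXE := expander_minn expX sSX.
have {}leS : (#|S|%:R <=
    (minn #|SX| (#|simplices X 2| - #|SX|))%:R + 2 * m%:R :> R)%R.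
  by rewrite -natrM -natrD ler_nat.
have {}leE : (#|edge_boundary (face_adj X) SX|%:R <= E%:R + d%:R :> R)%R.
  by rewrite -natrD ler_nat; lia.
have m_ge0 : (0 <= m%:R :> R)%R by [].
have d_ge0 : (0 <= d%:R :> R)%R by [].
have E_ge1 : (1 <= E%:R :> R)%R by rewrite ler1n.
have den_gt0 : (0 < 1 + d%:R + 2 * c * m%:R)%R by nra.
rewrite mulrAC ler_pdivrMr //.
have cm_ge0 : (0 <= 2 * c * m%:R)%R by nra.
(* The estimates above give c|S| <= E + (d + 2cm); as E >= 1, the additive term is at most E times
   itself. *)
apply: (@le_trans _ _ (E%:R + (d%:R + 2 * c * m%:R))%R).
  rewrite addrA -lerBlDr; apply: le_trans leE; apply: le_trans leSXE.
  rewrite -subr_ge0; move: leS; rewrite -(ler_pM2l c_gt0); lra.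
rewrite -addrA mulrDr mulr1 lerD2l; apply: ler_peMl => //; exact: addr_ge0.
Qed.

(** * Transfer between sets of triangles and the dual graph *)

Section DualExpansion.
Variables (R : realFieldType) (T : finType) (X : {set {set T}}) (c : R).
Hypothesis capX : forall A B, face_adj X A B -> A :&: B \in X.

Lemma card_dual_vertex : #|dual_vertex X| = #|simplices X 2|.
Proof. by rewrite card_sig; apply: eq_card => A; rewrite !inE. Qed.

Lemma face_adj_expansion :
  (forall S : {set dual_vertex X}, 2 * #|S| <= #|dual_vertex X| ->
     (c * #|S|%:R <= #|edge_boundary (dual_graph X) S|%:R)%R) ->
  forall Z : {set {set T}}, Z \subset simplices X 2 ->
    2 * #|Z| <= #|simplices X 2| ->
    (c * #|Z|%:R <= #|edge_boundary (face_adj X) Z|%:R)%R.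
Proof.
move=> expX Z sZ leZ; pose S : {set dual_vertex X} := [set a | val a \in Z].
have defZ : Z = [set val a | a in S].
  apply/setP=> A; apply/idP/imsetP => [ZA | [a + ->]]; last by rewrite inE.
  by exists (Sub A (subsetP sZ A ZA)); rewrite ?inE SubK.
have cZ : #|Z| = #|S| by rewrite [in LHS]defZ card_imset //; apply: val_inj.
rewrite cZ [Z in edge_boundary _ Z]defZ -card_edge_boundary_val //.
by apply: expX; rewrite -cZ card_dual_vertex.
Qed.

Lemma dual_expansion :
  (forall Z : {set {set T}}, Z \subset simplices X 2 -> 0 < #|Z| ->
    2 * #|Z| <= #|simplices X 2| ->
    (c * #|Z|%:R <= #|edge_boundary (face_adj X) Z|%:R)%R) ->
  forall S : {set dual_vertex X}, 0 < #|S| -> 2 * #|S| <= #|dual_vertex X| ->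
     (c * #|S|%:R <= #|edge_boundary (dual_graph X) S|%:R)%R.
Proof.
move=> expX S S_gt0 leS; rewrite card_edge_boundary_val //.
have cS : #|[set val a | a in S]| = #|S|.
  by rewrite card_imset //; apply: val_inj.
rewrite -cS; apply: expX; rewrite ?cS // -?card_dual_vertex //.
by apply/subsetP=> _ /imsetP[a _ ->]; apply: (valP a).
Qed.

End DualExpansion.

(** * The connected sum with the Klein bottle *)

Lemma klein_punctured_const (s : {set klein_vertex})
    (P : pred {set klein_vertex}) :
  s \in simplices klein_bottle 2 ->
  {in simplices klein_bottle 2 :\ s &,
    forall A B, face_adj klein_bottle A B -> P A -> P B} ->
  {in simplices klein_bottle 2 :\ s &, forall A B, P A -> P B}.
Proof.
rewrite klein_facesE => c_s PP.
have inE' A : (A \in simplices klein_bottle 2 :\ s)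
    = (A \in [pred A in [seq klein_face p | p <- klein_cycle] | A != s]).
  by rewrite in_setD1 klein_facesE inE andbC.
move=> A B; rewrite !inE'.
apply: (cycle_pred_const klein_faces_uniq klein_faces_cycle c_s).
  exact: face_adj_sym.
by move=> C C' cC cC'; apply: PP; rewrite inE'.
Qed.

Section SurfaceKlein.
Variables (R : realFieldType) (T : finType) (X : {set {set T}}) (c : R).
Variables (t : {set T}) (s : {set klein_vertex}) (f : klein_vertex -> T).
Hypotheses (surfX : closed_surface X) (Xt : t \in simplices X 2).
Hypotheses (Ks : s \in simplices klein_bottle 2) (f_glue : f @: s = t).
Local Notation U := (connected_sum X klein_bottle t s f).

Lemma klein_sum_cap A B : face_adj U A B -> A :&: B \in U.
Proof.
apply: connected_sum_cap => //; first exact: surface_subset.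
exact: klein_subset.
Qed.

(** A neighbour of [t] and the triangle facing it across the seam are two triangles of the sum. This
    makes the infimum defining the Cheeger constant range over a nonempty set. *)
Lemma klein_sum_card_dual : 1 < #|dual_vertex U|.
Proof.
have [E sEt cE] : exists2 E : {set T}, E \subset t & #|E| = 2.
  have: 0 < #|[set E : {set T} | (E \subset t) && (#|E| == 2)]|.
    by rewrite cards_draws; move: Xt; rewrite inE => /andP[_ /eqP->].
  by case/card_gt0P=> E; rewrite inE => /andP[sEt /eqP]; exists E.
have [A XA /andP[A't sEA]] := edge_triangle surfX Xt sEt cE.
have adjAt := edge_face_adj XA Xt A't sEA sEt cE.
have [B KB adjAB] := face_adj_across Xt Ks f_glue klein_edge_triangle adjAt.
move: adjAB; set P := [set inl x | x in A]; set Q := [set glue _ _ v | v in B].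
case/and4P=> UP UQ P'Q _; rewrite card_dual_vertex.
have /subset_leq_card : [set P; Q] \subset simplices U 2.
  by rewrite subUset !sub1set UP.
by rewrite cards2 P'Q.
Qed.

Lemma klein_sum_expansion : (0 < c)%R ->
  (forall S : {set dual_vertex X}, 2 * #|S| <= #|dual_vertex X| ->
     (c * #|S|%:R <= #|edge_boundary (dual_graph X) S|%:R)%R) ->
  forall S : {set dual_vertex U}, 0 < #|S| -> 2 * #|S| <= #|dual_vertex U| ->
     (c / (4 + 2 * c * #|simplices klein_bottle 2|%:R) * #|S|%:R
      <= #|edge_boundary (dual_graph U) S|%:R)%R.
Proof.
move=> c_gt0 expX; apply: dual_expansion; first exact: klein_sum_cap.
(* Here 3 is the bound on the degree of [t]. *)
have -> : (4 = 1 + 3%:R :> R)%R by rewrite -natr1 addrC.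
apply: connected_sum_expander => //.
- exact: klein_subset.
- exact: klein_edge_triangle.
- by move=> P; apply: klein_punctured_const.
- exact: degree_le3.
by apply: face_adj_expansion => //; apply: surface_cap.
Qed.

End SurfaceKlein.

(** * Rayleigh quotients *)

Local Open Scope ring_scope.

(** Over [R[i]] the symmetric matrix [A] is Hermitian, hence diagonalised by a unitary matrix [P];
    in the coordinates [y] its quadratic form is the sum of the d_i |y_i|^2. *)
Lemma rayleigh_ge (R : rcfType) n (A : 'M[R]_n) (a : R) (x : 'rV[R]_n) :
  A^T = A -> (forall b, eigenvalue A b -> a <= b) ->
  a * (x *m x^T) 0 0 <= (x *m A *m x^T) 0 0.
Proof.
move=> symA a_min; pose f : {rmorphism R -> R[i]} := real_complex R.
have f_real (r : R) : f r \is Num.real by apply/complex_realP; exists r.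
have realf m p (M : 'M[R]_(m, p)) : map_mx Num.conj (map_mx f M) = map_mx f M.
  by apply: realmxC; apply/mxOverP => i j; rewrite mxE.
pose AC := map_mx f A.
have hermA : AC \is hermsymmx.
  apply/is_hermitianmxP; rewrite expr0 scale1r /AC.
  by rewrite map_trmx symA realf.
have /hermitian_normalmx /orthomx_spectralP A_eq := hermA.
set P := spectralmx AC in A_eq; set d := spectral_diag AC in A_eq.
have unitP : P \is unitarymx := spectral_unitarymx _.
(* Each d_i is real and has row [i] of [P] as an eigenvector, so it comes from an eigenvalue of [A]
   over [R]. *)
have d_ge i : f a <= d 0 i.
  have /mxOverP/(_ 0 i)/complex_realP [b d_eq] :=
    hermitian_spectral_diag_real hermA.
  have PA : P *m AC = diag_mx d *m P.
    by rewrite A_eq !mulmxA mulmxV ?mul1mx // unitarymx_unit.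
  rewrite -/d in d_eq; rewrite d_eq lecR; apply: a_min.
  rewrite -(eigenvalue_map f); apply/eigenvalueP; exists (row i P).
    by rewrite -row_mul PA row_mul row_diag_mx -scalemxAl -rowE d_eq.
  apply: contraTneq (unitarymx_unit unitP) => Pi0.
  apply/negP => /mulmxV /(congr1 (row i)); rewrite row_mul Pi0 mul0mx.
  move=> /rowP /(_ i); rewrite !mxE eqxx => /eqP.
  by rewrite eq_sym oner_eq0.
pose y := map_mx f x *m invmx P.
have ytE : P *m (map_mx f x)^T = map_mx Num.conj y^T.
  by rewrite trmx_mul map_mxM invmx_unitary // !map_trmx trmxK map_mxCK realf.
have xE : map_mx f x = y *m P by rewrite mulmxKV // unitarymx_unit.
have qE : f ((x *m A *m x^T) 0 0) = \sum_i d 0 i * `|y 0 i| ^+ 2.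
  transitivity (map_mx f (x *m A *m x^T) 0 0); first by rewrite [RHS]mxE.
  rewrite !map_mxM -map_trmx -/AC A_eq !mulmxA -/y -mulmxA ytE.
  rewrite mul_mx_diag mxE; apply: eq_bigr => i _.
  by rewrite !mxE mulrAC [_ * d _ _]mulrC normCK mulrA.
have nE : f ((x *m x^T) 0 0) = \sum_i `|y 0 i| ^+ 2.
  transitivity (map_mx f (x *m x^T) 0 0); first by rewrite [RHS]mxE.
  rewrite !map_mxM -map_trmx {1}xE -mulmxA ytE mxE; apply: eq_bigr => i _.
  by rewrite !mxE normCK.
rewrite -lecR -!/(f _) rmorphM nE qE mulr_sumr.
by apply: ler_sum => i _; rewrite ler_wpM2r // exprn_ge0.
Qed.

Lemma dotmxx_ge0 (R : realFieldType) n (v : 'rV[R]_n) : 0 <= (v *m v^T) 0 0.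
Proof. by rewrite mxE sumr_ge0 // => i _; rewrite mxE -expr2 sqr_ge0. Qed.

Lemma dotmxx_eq0 (R : realFieldType) n (v : 'rV[R]_n) :
  ((v *m v^T) 0 0 == 0) = (v == 0).
Proof.
apply/eqP/eqP => [|->]; last by rewrite mul0mx mxE.
rewrite mxE => /eqP; rewrite psumr_eq0 => [/allP v0|i _]; last first.
  by rewrite mxE -expr2 sqr_ge0.
apply/rowP=> i; have := v0 i (mem_index_enum i).
by rewrite !mxE -expr2 sqrf_eq0 => /eqP.
Qed.

(** The quadratic form of the Gram matrix at [v] is the squared norm of the image of [v] under [B].
    An eigenvector for [a] gives the sign, and the Rayleigh bound at [x] the inequality. *)
Lemma gram_smallest_eigenvalue (R : rcfType) m n (B : 'M[R]_(m, n)) (a : R)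
    (x : 'I_n -> R) : smallest_eigenvalue (B^T *m B) a ->
  0 <= a /\ a * (\sum_j x j ^+ 2) <= \sum_i (\sum_j x j * B i j) ^+ 2.
Proof.
have gramE (v : 'rV[R]_n) : v *m (B^T *m B) *m v^T = (v *m B^T) *m (v *m B^T)^T.
  by rewrite trmx_mul trmxK !mulmxA.
case=> /eigenvalueP[v /(congr1 (mulmx^~ v^T)) eq_v v_neq0] a_min; split.
  have v_gt0 : 0 < (v *m v^T) 0 0.
    by rewrite lt_def dotmxx_eq0 v_neq0 dotmxx_ge0.
  rewrite -(pmulr_lge0 _ v_gt0); have /matrixP/(_ 0 0) := eq_v.
  by rewrite gramE -scalemxAl [in RHS]mxE => <-; apply: dotmxx_ge0.
have symB : (B^T *m B)^T = B^T *m B by rewrite trmx_mul trmxK.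
have := rayleigh_ge (\row_j x j) symB a_min; rewrite gramE !mxE.
congr (a * _ <= _); apply: eq_bigr => i _; rewrite !mxE -expr2 //.
by congr (_ ^+ 2); apply: eq_bigr => j _; rewrite !mxE.
Qed.

(** * The orientation chain of a punctured surface *)

(** The enumeration of a sum type lists the left summand first. Hence [inl] respects reference
    orientations, as [incidence_left] requires. *)
Lemma inl_enum_rank (T T' : finType) (x : T) :
  (enum_rank (inl x : T + T')%type : nat) = enum_rank x.
Proof.
have rankE (W : finType) (w : W) : (enum_rank w : nat) = index w (enum W).
  rewrite -[in RHS](nth_enum_rank w w) index_uniq ?enum_uniq //.
  by rewrite -cardE.
rewrite !rankE !enumT [in LHS]unlock /sum_enum index_cat -!enumT.
rewrite map_f ?mem_enum // index_map //; exact: inl_inj.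
Qed.

Section Incidence.
Variable T : finType.
Implicit Types A E : {set T}.

Lemma incidence_intr (R : nzRingType) A E :
  incidence R A E = (incidence int A E)%:~R.
Proof.
by rewrite rmorph_sum; apply: eq_bigr => v _; rewrite rmorphXn rmorphN1.
Qed.

Lemma incidence_eq0 (R : nzRingType) A E :
  ~~ (E \subset A) -> incidence R A E = 0.
Proof.
move=> nsEA; apply: big_pred0 => v; apply/negP=> /andP[_ /eqP defE].
by rewrite defE subsetDl in nsEA.
Qed.

Lemma sqr_incidence_le1 (R : realFieldType) A E : incidence R A E ^+ 2 <= 1.
Proof.
case: (pickP [pred v in A | E == A :\ v]) => [v|pr0]; last first.
  by rewrite /incidence big_pred0 // expr0n.
case/andP=> Av /eqP defE.
rewrite /incidence (big_pred1 v) ?sqrr_sign // => w; rewrite /= defE.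
apply/andP/eqP => [[Aw /eqP/setP/(_ w)] | ->]; last by [].
by rewrite !inE eqxx Aw andbT => /negbFE/eqP.
Qed.

Lemma incidence_left (R : nzRingType) (T' : finType) A E :
  incidence R ([set inl x | x in A] : {set T + T'}) [set inl x | x in E]
  = incidence R A E.
Proof.
have injl := @inl_inj T T'.
have leftD1 v : [set inl x | x in A] :\ inl v
    = [set inl x | x in A :\ v] :> {set T + T'}.
  apply/setP=> w; apply/setD1P/imsetP => [[w'v /imsetP[x Ax def_w]] | [x + ->]].
    by exists x; rewrite // !inE Ax andbT -(inj_eq injl) -def_w.
  by rewrite !inE => /andP[x'v Ax]; rewrite (inj_eq injl) imset_f.
rewrite /incidence big_mkcondr big_imset /=; last exact: in2W.
rewrite -big_mkcondr /=; apply: eq_big => [v | v /andP[Av _]].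
  by rewrite leftD1 (inj_eq (imset_inj injl)).
congr ((-1) ^+ _); rewrite -(card_imset _ injl); apply: eq_card => w.
rewrite !inE; apply/andP/imsetP => [[/imsetP[u Au ->]] | [u]].
  by rewrite !inl_enum_rank => lt_uv; exists u; rewrite ?inE ?Au.
by rewrite inE => /andP[Au lt_uv] ->; rewrite imset_f // !inl_enum_rank.
Qed.

End Incidence.

Section TestChain.
Variables (R : rcfType) (T T' : finType).
Variables (X : {set {set T}}) (Y : {set {set T'}}).
Variables (t : {set T}) (s : {set T'}) (f : T' -> T).
Hypothesis surfX : closed_surface X.
Hypotheses (Xt : t \in simplices X 2) (Ys : s \in simplices Y 2).
Hypothesis f_glue : f @: s = t.
Variable o : {set T} -> bool.
Hypothesis oriX : forall A B E, A \in simplices X 2 -> B \in simplices X 2 ->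
  A != B -> E \in simplices X 1 -> E \subset A -> E \subset B ->
  (-1) ^+ o A * incidence int A E + (-1) ^+ o B * incidence int B E = 0.

Local Notation U := (connected_sum X Y t s f).
Local Notation left A := ([set inl x | x in A] : {set T + T'}).

(** The chain of signs given by [o] is a cycle: exactly two triangles contain [E], and their
    contributions cancel. *)
Lemma oriented_boundary (E : {set T}) : E \in simplices X 1 ->
  \sum_(A in simplices X 2) (-1) ^+ o A * incidence R A E = 0.
Proof.
move=> XE; have /eqP/cards2P[A [B [A'B defAB]]] := edge_triangles surfX XE.
have inAB C : (C \in simplices X 2) && (E \subset C) = (C \in [set A; B]).
  by rewrite -defAB inE.
rewrite (bigID (fun C : {set T} => E \subset C)) /= addrC.
rewrite big1 => [|C /andP[_ nsEC]].
  rewrite add0r (eq_bigl _ _ inAB) big_setU1 ?inE // big_set1.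
  have := set21 A B; rewrite -inAB => /andP[XA sEA].
  have := set22 A B; rewrite -inAB => /andP[XB sEB].
  have /(congr1 (fun z : int => z%:~R : R)) := oriX XA XB A'B XE sEA sEB.
  by rewrite rmorphD !rmorphM !rmorphXn !rmorphN1 /= -!incidence_intr.
by rewrite incidence_eq0 ?mulr0.
Qed.

(** The test chain, as a push-forward along [inl]: the sum has at most one term, and none when [C]
    is not the image of a triangle of [X] other than [t]. *)
Definition punctured_chain (C : {set T + T'}) : R :=
  \sum_(A in simplices X 2 :\ t | left A == C) (-1) ^+ o A.

Lemma punctured_chain_sum (F : {set T + T'} -> R) :
  \sum_(C in simplices U 2) punctured_chain C * F C
  = \sum_(A in simplices X 2 :\ t) (-1) ^+ o A * F (left A).
Proof.
under eq_bigr do rewrite mulr_suml.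
rewrite (exchange_big_dep (mem (simplices X 2 :\ t))) /=.
  apply: eq_bigr => A XA; rewrite (big_pred1 (left A)) // => C.
  by rewrite XA /= eq_sym; case: eqP => [->|]; rewrite ?andbF // left_face.
by move=> C A _ /andP[].
Qed.

Lemma punctured_chain_left (A : {set T}) : A \in simplices X 2 :\ t ->
  punctured_chain (left A) = (-1) ^+ o A.
Proof.
move=> XA; rewrite /punctured_chain (big_pred1 A) // => B /=.
rewrite (inj_eq (imset_inj (@inl_inj T T'))).
by case: eqP => [->|]; rewrite ?andbF ?XA.
Qed.

Lemma punctured_chain_norm :
  \sum_(C in simplices U 2) punctured_chain C ^+ 2 = (#|simplices X 2|.-1)%:R.
Proof.
under eq_bigr do rewrite expr2; rewrite punctured_chain_sum.
rewrite (eq_bigr (fun=> 1)) => [|A XA].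
  by rewrite sumr_const (cardsD1 t (simplices X 2)) Xt.
by rewrite punctured_chain_left // -expr2 sqrr_sign.
Qed.

(** On an edge of a remaining triangle of [X], the boundary coefficient is minus the term of [t] in
    [oriented_boundary]: its square is at most 1 on the three edges of [t] and 0 off them. On all
    other edges no term contributes. *)
Lemma punctured_chain_boundary :
  \sum_(E in simplices U 1)
    (\sum_(C in simplices U 2) punctured_chain C * incidence R C E) ^+ 2 <= 3.
Proof.
pose Et := [set E : {set T} | (E \subset t) && (#|E| == 2)%N].
pose D := [set left E | E : {set T} in Et].
have cardD : (#|D| <= 3)%N.
  apply: leq_trans (leq_imset_card _ _) _; rewrite cards_draws.
  by move: Xt; rewrite inE => /andP[_ /eqP->].
pose indD E : R := if E \in D then 1 else 0.
apply: (@le_trans _ _ (\sum_(E in simplices U 1) indD E)); last first.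
  rewrite -big_mkcondr /= sumr_const ler_nat; apply: leq_trans cardD.
  by apply/subset_leq_card/subsetP=> E /andP[].
have indD_ge0 E : 0 <= indD E by rewrite /indD; case: ifP.
apply: ler_sum => E UE; rewrite punctured_chain_sum.
have cE : #|E| = 2 by move: UE; rewrite inE => /andP[_ /eqP].
have [exA | noA] := boolP [exists A in simplices X 2 :\ t, E \subset left A];
  last first.
  rewrite big1 ?expr0n // => A XA; rewrite incidence_eq0 ?mulr0 //.
  by apply: contra noA => sEA; apply/existsP; exists A; rewrite XA.
have /existsP[A /andP[XA /subset_imset_ex[E0 sE0A defE]]] := exA.
have cE0 : #|E0| = 2 by rewrite -cE defE card_left.
have XE0 : E0 \in simplices X 1.
  move: XA; rewrite !inE cE0 eqxx andbT => /and3P[_ XA _].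
  by apply: (surface_subset surfX XA); rewrite // -card_gt0 cE0.
have := oriented_boundary XE0; rewrite (big_setD1 t Xt) /= => /eqP.
rewrite addrC addr_eq0 => /eqP sumE.
rewrite (eq_bigr (fun B => (-1) ^+ o B * incidence R B E0)) => [|B _];
  last first.
  by rewrite defE incidence_left.
have -> : \sum_(B in simplices X 2 :\ t) (-1) ^+ o B * incidence R B E0
    = - ((-1) ^+ o t * incidence R t E0).
  by rewrite -sumE; apply: eq_bigl => B; rewrite !inE.
rewrite sqrrN exprMn sqrr_sign mul1r.
have [sE0t | nsE0t] := boolP (E0 \subset t); last first.
  by rewrite incidence_eq0 // expr0n.
by rewrite /indD defE imset_f ?inE ?sE0t ?cE0 //= sqr_incidence_le1.
Qed.

Lemma smallest_eigenvalue_connected_sum (a : R) :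
  smallest_eigenvalue (down_laplacian U R 2) a ->
  0 <= a /\ a * (#|simplices X 2|.-1)%:R <= 3.
Proof.
move=> /(gram_smallest_eigenvalue (fun j => punctured_chain (enum_val j))).
case=> a_ge0 le_a; split=> //; move: le_a.
rewrite -(big_enum_val (fun C => punctured_chain C ^+ 2)) punctured_chain_norm.
move/le_trans; apply; apply: le_trans punctured_chain_boundary.
rewrite [in leRHS]big_enum_val /=; apply: ler_sum => i _.
rewrite [in leRHS]big_enum_val /=.
under eq_bigr do rewrite mxE.
by [].
Qed.
End TestChain.

(** * Cheeger constants *)

From mathcomp Require Import all_classical all_reals all_analysis.
Import numFieldNormedType.Exports.
Local Open Scope classical_set_scope.
Local Open Scope ring_scope.

Section Cheeger.
Variables (R : realType) (W : finType) (e : rel W) (c : R).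

Lemma cheeger_ge_expansion : c <= cheeger R e ->
  forall S : {set W}, (2 * #|S| <= #|W|)%N ->
    c * #|S|%:R <= #|edge_boundary e S|%:R.
Proof.
move=> le_c S leS; have [->|S_gt0] := posnP #|S|; first by rewrite mulr0 ler0n.
rewrite -ler_pdivlMr ?ltr0n //; apply: le_trans le_c _; apply: ge_inf.
  by exists 0 => _ [Z [_ _ ->]]; rewrite divr_ge0 ?ler0n.
by exists S.
Qed.

Lemma expansion_cheeger_ge : (1 < #|W|)%N ->
  (forall S : {set W}, (0 < #|S|)%N -> (2 * #|S| <= #|W|)%N ->
    c * #|S|%:R <= #|edge_boundary e S|%:R) ->
  c <= cheeger R e.
Proof.
move=> W_gt1 exp_c; apply: lb_le_inf; last first.
  by move=> _ [S [S_gt0 leS ->]]; rewrite ler_pdivlMr ?ltr0n // exp_c.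
(* A singleton is admissible when there are at least two vertices, so the infimum is not taken over
   the empty set. *)
have /card_gt0P[w _] := ltnW W_gt1.
exists (#|edge_boundary e [set w]%SET|%:R / #|[set w]%SET|%:R), [set w]%SET.
by rewrite cards1 muln1.
Qed.

End Cheeger.

Theorem proposition6p2 (R : realType)
  (V : nat -> finType) (L : forall k, {set {set V k}})
  (L_surface : forall k, (2 <= k)%N -> closed_surface (L k))
  (L_orientable : forall k, (2 <= k)%N -> orientable (L k))
  (L_infty : (fun k => #|simplices (L k) 2|) @ \oo --> \oo)
  (c : R) (c_gt0 : 0 < c)
  (L_expander : forall k, (2 <= k)%N ->
     c <= cheeger R (dual_graph (L k)))
  (t : forall k, {set V k}) (s : nat -> {set klein_vertex})
  (f : forall k, klein_vertex -> V k)
  (t_simplex : forall k, (2 <= k)%N -> t k \in simplices (L k) 2)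
  (s_simplex : forall k, (2 <= k)%N -> s k \in simplices klein_bottle 2)
  (f_glue : forall k, (2 <= k)%N -> [set f k v | v in s k]%SET = t k)
  (lambda_min : nat -> R)
  (lambda_minP : forall k, (2 <= k)%N ->
     smallest_eigenvalue
       (down_laplacian
          (connected_sum (L k) klein_bottle (t k) (s k) (f k)) R 2)
       (lambda_min k)) :
  (exists eps : R, 0 < eps /\
     forall k, (2 <= k)%N ->
       eps < h_vol R (connected_sum (L k) klein_bottle (t k) (s k) (f k))) /\
  lambda_min k @[k --> \oo] --> 0.
Proof.
split.
  pose eps := c / (4 + 2 * c * #|simplices klein_bottle 2|%:R).
  have eps_gt0 : 0 < eps.
    by rewrite divr_gt0 // ltr_wpDr // !mulr_ge0 ?ler0n // ltW.
  (* Halving turns the bound by [eps] into a strict one. *)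
  exists (eps / 2); split=> [|k k_ge2]; first by rewrite divr_gt0.
  apply: (@lt_le_trans _ _ eps).
    by rewrite ltr_pdivrMr // ltr_pMr // ltr1n.
  have [surfL Lt] := (L_surface k k_ge2, t_simplex k k_ge2).
  have [Ks glueK] := (s_simplex k k_ge2, f_glue k k_ge2).
  apply: expansion_cheeger_ge; first exact: klein_sum_card_dual.
  apply: klein_sum_expansion => //.
  exact/cheeger_ge_expansion/L_expander.
have lambda_bounds k : (2 <= k)%N ->
    0 <= lambda_min k /\ lambda_min k * (#|simplices (L k) 2|.-1)%:R <= 3.
  move=> k_ge2; have [orn ori] := L_orientable k k_ge2.
  have [surfL Lt] := (L_surface k k_ge2, t_simplex k k_ge2).
  have [Ks glueK] := (s_simplex k k_ge2, f_glue k k_ge2).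
  exact: (smallest_eigenvalue_connected_sum surfL Lt Ks glueK ori
            (lambda_minP k k_ge2)).
apply/cvgrPdist_lt => e e_gt0; near=> k.
have k_ge2 : (2 <= k)%N by near: k; exists 2%N.
have [l_ge0 l_le] := lambda_bounds k k_ge2.
rewrite sub0r normrN ger0_norm //.
(* One unit makes up for the truncation and one for the removed triangle, so that n - 1 exceeds 3 /
   e. *)
have: ((Num.truncn (3 / e)).+2 <= #|simplices (L k) 2|)%N.
  by near: k; move/cvgnyPge: L_infty; apply.
rewrite -ltn_predRL => lt_n.
have n_gt : 3 / e < (#|simplices (L k) 2|.-1)%:R.
  by apply: lt_le_trans (truncnS_gt _) _; rewrite ler_nat.
have n_gt0 : 0 < (#|simplices (L k) 2|.-1)%:R :> R.
  by apply: le_lt_trans n_gt; rewrite divr_ge0 // ltW.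
rewrite -(ltr_pM2r n_gt0); apply: le_lt_trans l_le _.
by rewrite mulrC -ltr_pdivrMr.
Unshelve. all: by end_near.
Qed.
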